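(* Let $\Sigma$ be a set of equations in the language of relation algebras such that $\mathsf{RRA}=\mathsf{wRRA}\cap\mathrm{Mod}(\Sigma)$. Then the set of variables occurring in the equations of $\Sigma$ is infinite.
   Context: A relation algebra is an algebra $(A,0,1,\overline{\phantom{x}},+,\cdot,1',\breve{\ },;)$ where $(A,0,1,\overline{\phantom{x}},+,\cdot)$ is a Boolean algebra, $;$ is associative with identity $1'$, $\breve{\ }$ is unary, and the following hold: $x;(y+z)=x;y+x;z$, $(x+y)\breve{}=\breve x+\breve y$, $\breve{\breve x}=x$, $(x;y)\breve{}=\breve y;\breve x$, and $\breve x;\overline{x;y}\le\overline y$. A representation of a relation algebra $\mathfrak A$ with unit an equivalence relation $U$ on a set $D$ is an injective map $\theta:\mathfrak A\to\mathcal P(U)$ with $0^\theta=\emptyset$, $1^\theta=U$, $\overline{x}^\theta=U\setminus x^\theta$, $(x+y)^\theta=x^\theta\cup y^\theta$, $(x\cdot y)^\theta=x^\theta\cap y^\theta$, $(1')^\theta=\{(u,u):u\in D\}$, $\breve x^\theta=(x^\theta)^{-1}$, $(x;y)^\theta=x^\theta|y^\theta$ (relational composition). A weak representation is an injective map with the same properties except that it need not respect $+$ or complementation (i.e. it respects $0,1,\cdot,1',\breve{\ },;$). $\mathsf{RRA}$ and $\mathsf{wRRA}$ denote the classes of relation algebras having a representation, respectively a weak representation; both are equational varieties. $\mathrm{Mod}(\Sigma)$ is the class of algebras satisfying all equations in $\Sigma$. *)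

(* Defs.v *)
From Stdlib Require Import List.

Record ra_sig := RASig {
  car :> Type;
  r0 : car; r1 : car;
  rcompl : car -> car;
  radd : car -> car -> car;
  rmul : car -> car -> car;
  rid : car;
  rconv : car -> car;
  rcomp : car -> car -> car
}.

Definition rle (A : ra_sig) (x y : A) : Prop := radd A x y = y.

Definition is_RA (A : ra_sig) : Prop :=
  (forall x y z : A, radd A x (radd A y z) = radd A (radd A x y) z) /\
  (forall x y z : A, rmul A x (rmul A y z) = rmul A (rmul A x y) z) /\
  (forall x y : A, radd A x y = radd A y x) /\
  (forall x y : A, rmul A x y = rmul A y x) /\
  (forall x y : A, radd A x (rmul A x y) = x) /\
  (forall x y : A, rmul A x (radd A x y) = x) /\
  (forall x y z : A, rmul A x (radd A y z) = radd A (rmul A x y) (rmul A x z)) /\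
  (forall x y z : A, radd A x (rmul A y z) = rmul A (radd A x y) (radd A x z)) /\
  (forall x : A, radd A x (r0 A) = x) /\
  (forall x : A, rmul A x (r1 A) = x) /\
  (forall x : A, radd A x (rcompl A x) = r1 A) /\
  (forall x : A, rmul A x (rcompl A x) = r0 A) /\
  (forall x y z : A, rcomp A x (rcomp A y z) = rcomp A (rcomp A x y) z) /\
  (forall x : A, rcomp A x (rid A) = x) /\
  (forall x : A, rcomp A (rid A) x = x) /\
  (forall x y z : A, rcomp A x (radd A y z) = radd A (rcomp A x y) (rcomp A x z)) /\
  (forall x y : A, rconv A (radd A x y) = radd A (rconv A x) (rconv A y)) /\
  (forall x : A, rconv A (rconv A x) = x) /\
  (forall x y : A, rconv A (rcomp A x y) = rcomp A (rconv A y) (rconv A x)) /\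
  (forall x y : A, rle A (rcomp A (rconv A x) (rcompl A (rcomp A x y))) (rcompl A y)).

Definition rel (D : Type) := D -> D -> Prop.
Definition releq {D : Type} (R S : rel D) : Prop := forall u v, R u v <-> S u v.
Definition relcomp {D : Type} (R S : rel D) : rel D :=
  fun u v => exists w, R u w /\ S w v.

Definition is_equivalence {D : Type} (U : rel D) : Prop :=
  (forall u, U u u) /\ (forall u v, U u v -> U v u) /\
  (forall u v w, U u v -> U v w -> U u w).

Definition weak_rep (A : ra_sig) (D : Type) (U : rel D) (th : A -> rel D) : Prop :=
  is_equivalence U /\
  (forall x u v, th x u v -> U u v) /\
  (forall x y, releq (th x) (th y) -> x = y) /\
  releq (th (r0 A)) (fun _ _ => False) /\
  releq (th (r1 A)) U /\
  (forall x y, releq (th (rmul A x y)) (fun u v => th x u v /\ th y u v)) /\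
  releq (th (rid A)) (fun u v => u = v) /\
  (forall x, releq (th (rconv A x)) (fun u v => th x v u)) /\
  (forall x y, releq (th (rcomp A x y)) (relcomp (th x) (th y))).

Definition rep (A : ra_sig) (D : Type) (U : rel D) (th : A -> rel D) : Prop :=
  weak_rep A D U th /\
  (forall x, releq (th (rcompl A x)) (fun u v => U u v /\ ~ th x u v)) /\
  (forall x y, releq (th (radd A x y)) (fun u v => th x u v \/ th y u v)).

Definition RRA (A : ra_sig) : Prop :=
  is_RA A /\ exists (D : Type) (U : rel D) (th : A -> rel D), rep A D U th.

Definition wRRA (A : ra_sig) : Prop :=
  is_RA A /\ exists (D : Type) (U : rel D) (th : A -> rel D), weak_rep A D U th.

Inductive term : Type :=
  | tvar : nat -> term
  | t0 : term
  | t1 : term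
  | tcompl : term -> term
  | tadd : term -> term -> term
  | tmul : term -> term -> term
  | tid : term
  | tconv : term -> term
  | tcomp : term -> term -> term.

Fixpoint eval (A : ra_sig) (env : nat -> A) (t : term) : A :=
  match t with
  | tvar n => env n
  | t0 => r0 A
  | t1 => r1 A
  | tcompl s => rcompl A (eval A env s)
  | tadd s u => radd A (eval A env s) (eval A env u)
  | tmul s u => rmul A (eval A env s) (eval A env u)
  | tid => rid A
  | tconv s => rconv A (eval A env s)
  | tcomp s u => rcomp A (eval A env s) (eval A env u)
  end.

Fixpoint occurs (n : nat) (t : term) : Prop :=
  match t with
  | tvar m => n = m
  | t0 | t1 | tid => False
  | tcompl s | tconv s => occurs n s
  | tadd s u | tmul s u | tcomp s u => occurs n s \/ occurs n u
  end.

Definition equation := (term * term)%type.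

Definition Mod (Sigma : equation -> Prop) (A : ra_sig) : Prop :=
  forall e, Sigma e -> forall env : nat -> A, eval A env (fst e) = eval A env (snd e).

Definition vars_of (Sigma : equation -> Prop) (n : nat) : Prop :=
  exists e, Sigma e /\ (occurs n (fst e) \/ occurs n (snd e)).

Definition infinite_set (P : nat -> Prop) : Prop :=
  ~ exists l : list nat, forall n, P n -> In n l.

(* Main.v *)
(** Suppose that [k] variables suffice. We exhibit a finite symmetric relation
    algebra that is weakly representable and not representable, but in which
    any [k] elements lie in a representable subalgebra; it then satisfies Sigma,
    a contradiction.

    Its diversity atoms are colours [g_i] ([i < m]) and atoms [s_j]; the only
    forbidden triangles are [(g_i, g_i, g_i)] and triples of distinct [s_j]'s.

    - It is not representable: over a [g_0]-edge [(u, u')] choose points [v_j]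
      such that [(u, v_j)] and [(v_j, u')] have labels [s_(j,0)] and [s_(j,1)].
      Edges between distinct [v_j]'s must be coloured, without monochromatic
      triangle, which is impossible by Ramsey's theorem if there are many [j].
    - If [m > 2 ^ k], two colours are not separated by the [k] elements. The
      subalgebra of all unions of inseparable classes of atoms then has a
      flexible atom, and is represented step by step.
    - A weak representation is also built step by step, on networks whose
      labels are sets [N(u, v)] of atoms with
      [N(u, w) <= N(u, v) ; N(v, w)]. The label of a pair of distinct points
      may contain the identity atom; such pairs are controlled by cliques. *)
Require Import Defs.
From mathcomp Require Import all_boot.
From mathcomp Require Import boolp.

Set Implicit Arguments.
Unset Strict Implicit.
Unset Printing Implicit Defensive.

(** * Step-by-step constructions: limits of growing networks *)

Section Limit.
Variables (L : Type) (Q : countType).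
Implicit Types (n : nat) (N : nat -> nat -> L).

Definition agree n N N' := forall u v, u < n -> v < n -> N u v = N' u v.

(** The limit agrees with a stage only on the points present at that stage; properties of this kind
    pass from the stage to the limit. *)
Definition local (P : nat -> (nat -> nat -> L) -> Prop) :=
  forall n N N', agree n N N' -> P n N -> P n N'.

Variables (Good : nat -> (nat -> nat -> L) -> Prop).
Variables (Sat : Q -> nat -> (nat -> nat -> L) -> Prop).
Hypothesis local_Good : local Good.
Hypothesis local_Sat : forall q, local (Sat q).
Hypothesis ext : forall q n N, Good n N ->
  exists n' N', [/\ n < n', agree n N N', Good n' N' & Sat q n' N'].

(* Stage [i] treats the request coded by the 2-adic valuation of [i + 1], so
   that every request comes back at arbitrarily late stages. *)
Lemma limit_network n0 N0 : Good n0 N0 ->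
  exists N, forall q b, exists n, [/\ b <= n, Good n N & Sat q n N].
Proof.
move=> G0; have [q0|noq] := pselect (inhabited Q); last first.
  by exists N0 => q; case: noq.
case: q0 => q0.
pose St := {s : nat * (nat -> nat -> L) | Good s.1 s.2}.
have step (q : Q) (s : St) : {s' : St |
    [/\ (sval s).1 < (sval s').1, agree (sval s).1 (sval s).2 (sval s').2
      & Sat q (sval s').1 (sval s').2]}.
  apply: cid; case: s => -[n N] /= GN.
  have [n' [N' [nn' aN GN' SN']]] := ext q GN.
  by exists (exist _ (n', N') GN').
pose req i : Q := odflt q0 (unpickle (logn 2 i.+1)).
pose st := fix st i : St :=
  if i is j.+1 then sval (step (req j) (st j)) else exist _ (n0, N0) G0.
pose num i := (sval (st i)).1; pose net i := (sval (st i)).2.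
have stS i : [/\ num i < num i.+1, agree (num i) (net i) (net i.+1)
      & Sat (req i) (num i.+1) (net i.+1)].
  by rewrite /num /net /=; case: (step _ _).
have num_ge i : i <= num i.
  by elim: i => // i IH; have [h _ _] := stS i; apply: leq_ltn_trans h.
have num_mono i j : i <= j -> num i <= num j.
  move=> /subnK <-; elim: (j - i) => // d IH.
  by have [h _ _] := stS (d + i); apply: leq_trans IH (ltnW h).
have agr i j : i <= j -> agree (num i) (net i) (net j).
  move=> /subnK <-; elim: (j - i) => // d IH u v hu hv.
  have [_ h _] := stS (d + i); rewrite IH // h //.
    by apply: leq_trans hu (num_mono _ _ (leq_addl _ _)).
  by apply: leq_trans hv (num_mono _ _ (leq_addl _ _)).
(* Stage [j] has at least [j] points, so stage [(maxn u v).+1] already labels the pair, and later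
   stages do not change it. *)
pose N u v := net (maxn u v).+1 u v.
have agrN i : agree (num i) (net i) N.
  move=> u v hu hv; rewrite /N; set j := (maxn u v).+1.
  have hj : u < num j /\ v < num j.
    by split; apply: leq_trans (num_ge j); rewrite ltnS ?leq_maxl ?leq_maxr.
  have [le|lt] := leqP i j; first by rewrite (agr i j).
  by rewrite (agr j i) ?(ltnW lt); case: hj.
(* The odd factor [3 ^ b] leaves the 2-adic valuation alone and pushes the stage beyond [b]. *)
exists N => q b; pose i := (2 ^ pickle q * 3 ^ b).-1.
have iE : i.+1 = 2 ^ pickle q * 3 ^ b by rewrite prednK // muln_gt0 !expn_gt0.
have reqi : req i = q.
  by rewrite /req iE lognM ?expn_gt0 // !lognX /= muln0 muln1 addn0 pickleK.
exists (num i.+1); split.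
- apply: leq_trans (num_ge _); rewrite iE.
  apply: leq_trans (ltnW (ltn_expl b (isT : 1 < 3))) _.
  by rewrite leq_pmull ?expn_gt0.
- by apply: (local_Good (agrN i.+1)); apply: (svalP (st i.+1)).
- by apply: (local_Sat (agrN i.+1)); have [_ _] := stS i; rewrite reqi.
Qed.
End Limit.

(** * Adding one point to a labelling *)

Section Extend.
Variables (L : Type) (o : L).
Implicit Types (n u v : nat) (N : nat -> nat -> L) (f : nat -> L).

Definition extend n N f u v :=
  if u == n then (if v == n then o else f v)
  else if v == n then f u else N u v.

Lemma extend_nn n N f : extend n N f n n = o.
Proof. by rewrite /extend eqxx. Qed.
Lemma extend_lt n N f u v : u < n -> v < n -> extend n N f u v = N u v.
Proof. by move=> un vn; rewrite /extend (ltn_eqF un) (ltn_eqF vn). Qed.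
Lemma extend_ltn n N f u : u < n -> extend n N f u n = f u.
Proof. by move=> un; rewrite /extend (ltn_eqF un) eqxx. Qed.
Lemma extend_nlt n N f u : u < n -> extend n N f n u = f u.
Proof. by move=> un; rewrite /extend (ltn_eqF un) eqxx. Qed.
(* The order matters: [extend_lt] would also match the new point. *)
Definition extendE := (extend_nn, extend_ltn, extend_nlt, extend_lt).

Lemma agree_extend n N f : agree n N (extend n N f).
Proof. by move=> u v un vn; rewrite extendE. Qed.
End Extend.

Lemma ltnS_case n u : u < n.+1 -> u = n \/ u < n.
Proof. by rewrite ltnS leq_eqVlt => /orP[/eqP|]; [left|right]. Qed.

(** * The symmetric algebra of consistent triangles *)

Section Algebra.
Variables (m : nat) (J : finType).
Local Notation S := ('I_m + J)%type.
Local Notation T := (option S).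
Implicit Types (a b c t : T) (x y z : {set T}) (i g : 'I_m) (d e s : S).

Definition tri3 d e s : bool :=
  match d, e, s with
  | inl i, inl j, inl k => ~~ ((i == j) && (j == k))
  | inr i, inr j, inr k => [|| i == j, j == k | i == k]
  | _, _, _ => true
  end.

Definition tri a b c : bool :=
  match a, b, c with
  | None, _, _ => b == c
  | _, None, _ => a == c
  | _, _, None => a == b
  | Some d, Some e, Some s => tri3 d e s
  end.

Definition scomp x y : {set T} :=
  [set c | [exists a in x, exists b in y, tri a b c]].

(** The complex algebra of the atom structure [tri], with [None] as the identity atom; atoms are
    self-converse, hence [id]. *)
Definition triangle_algebra : ra_sig :=
  @RASig {set T} set0 setT (@setC T) (@setU T) (@setI T) [set None] id scomp.

Lemma scompP x y c :
  reflect (exists a b, [/\ a \in x, b \in y & tri a b c]) (c \in scomp x y).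
Proof.
rewrite inE; apply: (iffP exists_inP) => [[a ax /exists_inP[b by_ h]]|].
  by exists a, b.
by move=> [a [b [ax by_ h]]]; exists a => //; apply/exists_inP; exists b.
Qed.

Lemma mem_scomp x y a b c : a \in x -> b \in y -> tri a b c -> c \in scomp x y.
Proof. by move=> ax by_ h; apply/scompP; exists a, b. Qed.

Lemma triC a b c : tri a b c = tri b a c.
Proof.
by case: a b c => [[i|i]|] [[j|j]|] [[k|k]|] //=; do !case: eqP => //; congruence.
Qed.

Lemma tri_rot a b c : tri a b c = tri b c a.
Proof.
by case: a b c => [[i|i]|] [[j|j]|] [[k|k]|] //=; do !case: eqP => //; congruence.
Qed.

Lemma tri_swap a b c : tri a b c = tri a c b.
Proof. by rewrite triC tri_rot. Qed.

Lemma triNx b c : tri None b c = (b == c). Proof. by []. Qed.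
Lemma trixN a b : tri a b None = (a == b).
Proof. by rewrite -tri_rot. Qed.
Lemma trixNx a c : tri a None c = (a == c).
Proof. by rewrite triC. Qed.

(** Makes a colour a nearly free choice: it suffices that it differs from one of the other two
    diversity atoms. *)
Lemma tri_gamma g e s :
  tri (Some (inl g)) (Some e) (Some s) = ~~ ((inl g == e) && (e == s)).
Proof. by case: e s => [i|j] [k|k] //; rewrite andbF. Qed.

Lemma tri_isosceles d e : d != e -> tri (Some d) (Some e) (Some e).
Proof.
case: d e => [i|i] [j|j] //= h; last by rewrite eqxx orbT.
by rewrite eqxx andbT; apply: contra h => /eqP ->.
Qed.

Lemma tri_equal d :
  tri (Some d) (Some d) (Some d) = if d is inr _ then true else false.
Proof. by case: d => i /=; rewrite !eqxx. Qed.

Lemma scompC x y : scomp x y = scomp y x.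
Proof.
by apply/setP=> c; apply/scompP/scompP => -[a [b [? ? ?]]]; exists b, a;
  rewrite triC.
Qed.

Lemma scompS x x' y y' : x \subset x' -> y \subset y' ->
  scomp x y \subset scomp x' y'.
Proof.
move=> /subsetP xx /subsetP yy; apply/subsetP=> c /scompP[a [b [ax by_ h]]].
exact: mem_scomp (xx _ ax) (yy _ by_) h.
Qed.

Hypothesis m3 : 3 <= m.

Lemma gamma_avoid (r : seq S) : size r < m -> exists g, inl g \notin r.
Proof.
move=> hr; pose f g : S := inl g.
have [/existsP[g hg]|] := boolP [exists g, f g \notin r]; first by exists g.
rewrite negb_exists => /forallP h; suff: m <= size r by rewrite leqNgt hr.
rewrite -[leqLHS]card_ord -(size_image f); apply: uniq_leq_size.
  by rewrite /image_mem map_inj_uniq ?enum_uniq // => u v [].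
by move=> _ /imageP[g _ ->]; have := h g; rewrite negbK.
Qed.

(** A colour other than [a] and [c] is consistent with [a], [b] on one side and with [c], [t] on the
    other; two atoms are avoided, hence three colours. The identity cases are degenerate. *)
Lemma scompA_le x y z :
  scomp x (scomp y z) \subset scomp (scomp x y) z.
Proof.
apply/subsetP=> t /scompP[a [w [ax /scompP[b [c [by_ cz hw]]] ht]]].
suff [v h1 h2] : exists2 v, tri a b v & tri v c t.
  by apply: (@mem_scomp _ _ v c) => //; apply: mem_scomp h1.
case: a {ax} ht => [a|]; last first.
  by move=> /eqP wt; exists b; rewrite ?triNx // -wt.
case: b {by_} hw => [b|]; last first.
  by rewrite triNx => /eqP -> ht; exists (Some a); rewrite ?trixNx.
case: c {cz} => [c|]; last first.
  by rewrite trixNx => /eqP <- ht; exists t; rewrite // trixNx.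
case: t => [t|]; last first.
  by rewrite trixN => hw /eqP e; exists (Some c); rewrite ?trixN // tri_rot e.
move=> _ _; have [|g] := @gamma_avoid [:: a; c]; first exact: m3.
rewrite !inE negb_or => /andP[ga gc].
exists (Some (inl g)); last by rewrite tri_gamma (negPf gc).
by rewrite tri_swap triC tri_gamma (negPf ga).
Qed.

Lemma scompA x y z : scomp x (scomp y z) = scomp (scomp x y) z.
Proof.
apply/eqP; rewrite eqEsubset scompA_le /=.
by rewrite scompC (scompC x (scomp y z)) (scompC x) (scompC y z) scompA_le.
Qed.

Lemma triangle_algebra_is_RA : is_RA triangle_algebra.
Proof.
rewrite /is_RA /rle /=; do !split.
- exact: setUA.
- exact: setIA.
- exact: setUC.
- exact: setIC.
- by move=> x y; rewrite (setIC x) setKI.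
- by move=> x y; rewrite (setUC x) setKU.
- exact: setIUr.
- exact: setUIr.
- exact: setU0.
- exact: setIT.
- exact: setUCr.
- exact: setICr.
- exact: scompA.
- move=> x; apply/setP=> c; apply/scompP/idP.
    by move=> [a [b [ax /set1P ->]]]; rewrite trixNx => /eqP <-.
  by move=> cx; exists c, None; rewrite set11 trixNx eqxx.
- move=> x; apply/setP=> c; apply/scompP/idP.
    by move=> [a [b [/set1P -> bx /eqP <-]]].
  by move=> cx; exists None, c; rewrite set11 triNx eqxx.
- move=> x y z; apply/setP=> c; rewrite in_setU; apply/scompP/orP.
    by move=> [a [b [ax /setUP[by_|bz] h]]]; [left|right]; apply: mem_scomp h.
  by move=> [] /scompP[a [b [ax by_ h]]]; exists a, b; rewrite in_setU by_ ?orbT.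
- exact: scompC.
- move=> x y; apply/setUidPr/subsetP=> c /scompP[a [b [ax]]].
  rewrite !in_setC => nb h; apply: contra nb => cy.
  by apply: mem_scomp ax cy _; rewrite tri_swap.
Qed.
End Algebra.

(** * Weak networks and their cliques *)

Section WeakNetworks.
Variables (m : nat) (J : finType).
Local Notation S := ('I_m + J)%type.
Local Notation T := (option S).
Implicit Types (t : T) (x y : {set T}) (g : 'I_m) (d e s : S).
Implicit Types (n u v w : nat) (N : nat -> nat -> {set T}) (A : nat -> Prop).

(* The common diversity atoms of a clique are what keeps the identity atom,
   placed in labels of distinct points, compatible with later extensions. *)
Definition clique n N A :=
  [/\ forall u, A u -> u < n,
      forall u v, A u -> A v -> None \in N u v
    & forall v, v < n -> ~ A v -> exists d, forall u, A u -> Some d \in N u v].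

(** [wn_div] keeps distinct points apart, since a label within [[set None]] will mean equality;
    [wn_clique] accounts for every occurrence of the identity atom. *)
Record weak_network n N : Prop := WeakNetwork {
  wn_sym : forall u v, u < n -> v < n -> N u v = N v u;
  wn_diag : forall u, u < n -> N u u = [set None];
  wn_div : forall u v, u < n -> v < n -> u != v -> exists d, Some d \in N u v;
  wn_comp : forall u v w, u < n -> v < n -> w < n ->
    N u w \subset scomp (N u v) (N v w);
  wn_clique : forall u v, u < n -> v < n -> None \in N u v ->
    exists A, [/\ clique n N A, A u & A v] }.

Lemma local_clique A : local (fun n N => clique n N A).
Proof.
move=> n N N' aN [An Anear Adiv]; split => // [u v Au Av|v vn nAv].
  by rewrite -aN ?Anear ?An.
have [d hd] := Adiv v vn nAv; exists d => u Au; rewrite -aN ?hd //; exact: An.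
Qed.

Lemma local_weak_network : local weak_network.
Proof.
move=> n N N' aN [sN dN vN cN kN]; split.
- by move=> u v un vn; rewrite -!aN // sN.
- by move=> u un; rewrite -aN // dN.
- by move=> u v un vn uv; rewrite -aN //; apply: vN.
- by move=> u v w un vn wn; rewrite -!aN //; apply: cN.
- move=> u v un vn; rewrite -aN // => /(kN u v un vn)[A [kA Au Av]].
  by exists A; split=> //; apply: local_clique kA.
Qed.

Hypothesis m4 : 4 <= m.

(** * One-point extensions of weak networks *)

Section Extension.
Variables (n : nat) (N : nat -> nat -> {set T}).
Hypothesis wN : weak_network n N.
Variables (a b : nat) (x y : {set T}).
Hypotheses (an : a < n) (bn : b < n).
Hypotheses (qxy : N a b \subset scomp x y) (xqy : x \subset scomp (N a b) y)
  (yqx : y \subset scomp (N a b) x).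
Variables (dx dy : S).
Hypotheses (xdx : Some dx \in x) (ydy : Some dy \in y).

(** The largest label between [u] and the new point that is allowed once the new point is joined to
    [a] by [x] and to [b] by [y]. *)
Definition room u := scomp (N u a) x :&: scomp (N u b) y.

Lemma roomP u t t1 t2 t3 t4 : t1 \in N u a -> t2 \in x -> tri t1 t2 t ->
  t3 \in N u b -> t4 \in y -> tri t3 t4 t -> t \in room u.
Proof.
by move=> ? ? ? ? ? ?; rewrite inE; apply/andP; split;
  [apply: (@mem_scomp _ _ _ _ t1 t2)|apply: (@mem_scomp _ _ _ _ t3 t4)].
Qed.

(** Both [N u a] and [N u b] contain a diversity atom, and [g] differs from [dx] and [dy], so
    neither triangle is blocked. *)
Lemma room_core g u : u < n -> u != a -> u != b -> inl g != dx -> inl g != dy ->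
  Some (inl g) \in room u.
Proof.
move=> un ua ub gx gy; have [p hp] := wn_div wN un an ua.
have [r hr] := wn_div wN un bn ub.
apply: (roomP hp xdx _ hr ydy).
  by rewrite tri_rot triC tri_gamma (negPf gx).
by rewrite tri_rot triC tri_gamma (negPf gy).
Qed.

Lemma core_avoid d :
  exists g, [/\ inl g != dx, inl g != dy & (inl g : S) != d].
Proof.
have [|g] := @gamma_avoid m J [:: dx; dy; d]; first exact: m4.
by rewrite !inE !negb_or => /and3P[]; exists g.
Qed.

(** [N a a] is the identity, so the first factor of the room is [x]; the second contains [x] by
    [xqy]. *)
Lemma room_a d : (Some d \in room a) = (Some d \in x).
Proof.
rewrite inE (wn_diag wN) //; apply/andP/idP => [[/scompP[t [s [/set1P-> sx]]]]|dxx].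
  by rewrite triNx => /eqP <-.
split; last exact: (subsetP xqy).
by apply: (@mem_scomp _ _ _ _ None (Some d)); rewrite ?set11 // triNx.
Qed.

Lemma room_b d : (Some d \in room b) = (Some d \in y).
Proof.
rewrite inE (wn_diag wN) // (wn_sym wN bn an).
apply/andP/idP => [[_ /scompP[t [s [/set1P-> sx]]]]|dxx].
  by rewrite triNx => /eqP <-.
split; first exact: (subsetP yqx).
by apply: (@mem_scomp _ _ _ _ None (Some d)); rewrite ?set11 // triNx.
Qed.

Lemma clique_common A : clique n N A -> ~ A a -> ~ A b ->
  exists d, forall u, A u -> Some d \in room u.
Proof.
move=> [An _ _] na nb; have [g [gx gy _]] := core_avoid dx.
exists (inl g) => u Au; apply: room_core => //; first exact: An.
  by apply/eqP => e; rewrite e in Au.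
by apply/eqP => e; rewrite e in Au.
Qed.

(** The atom [d] is copied from [a] to the whole clique through the identity atom in [N u a]; the
    common atom [e] towards [b] takes care of the other factor. *)
Lemma clique_common_a A d e t : clique n N A -> A a ->
  (forall u, A u -> Some e \in N u b) -> Some d \in x -> t \in y ->
  tri (Some d) t (Some e) -> forall u, A u -> Some d \in room u.
Proof.
move=> [_ near _] Aa eb dxx ty h u Au.
apply: (roomP (near u a Au Aa) dxx _ (eb u Au) ty); first by rewrite triNx.
by rewrite tri_rot triC.
Qed.

Lemma clique_common_b A d e t : clique n N A -> A b ->
  (forall u, A u -> Some e \in N u a) -> Some d \in y -> t \in x ->
  tri (Some d) t (Some e) -> forall u, A u -> Some d \in room u.
Proof.
move=> [_ near _] Ab ea dyy tx h u Au.
apply: (roomP (ea u Au) tx _ (near u b Au Ab) dyy); last by rewrite triNx.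
by rewrite tri_rot triC.
Qed.

Lemma clique_common_ab A d : clique n N A -> A a -> A b ->
  Some d \in x -> Some d \in y -> forall u, A u -> Some d \in room u.
Proof.
move=> [_ near _] Aa Ab dxx dyy u Au.
by apply: (roomP (near u a Au Aa) dxx _ (near u b Au Ab) dyy); rewrite triNx.
Qed.

(* [F] collects the cliques that the new point joins; every other clique keeps
   a common diversity atom towards it. *)
Variable F : (nat -> Prop) -> Prop.
Hypothesis F_clique : forall A, F A -> clique n N A.
Hypothesis F_room : forall A v, F A -> v < n -> ~ A v ->
  exists2 d, (forall u, A u -> Some d \in N u v) & Some d \in room v.
Hypothesis F_or_common : forall A, clique n N A ->
  F A \/ exists d, forall u, A u -> Some d \in room u.
Hypothesis F_a : (exists2 A, F A & A a) <-> None \in x.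
Hypothesis F_b : (exists2 A, F A & A b) <-> None \in y.

Definition new_label u : {set T} :=
  [set t | if t is Some _ then t \in room u else `[< exists2 A, F A & A u >]].

Lemma new_label_Some u d : (Some d \in new_label u) = (Some d \in room u).
Proof. by rewrite inE. Qed.

Lemma new_label_None u : None \in new_label u <-> exists2 A, F A & A u.
Proof. by rewrite inE; split => /asboolP. Qed.

Lemma new_label_a : new_label a = x.
Proof.
apply/setP=> -[d|]; first by rewrite new_label_Some room_a.
by apply/idP/idP; rewrite new_label_None; apply F_a.
Qed.

Lemma new_label_b : new_label b = y.
Proof.
apply/setP=> -[d|]; first by rewrite new_label_Some room_b.
by apply/idP/idP; rewrite new_label_None; apply F_b.
Qed.

Lemma new_label_div u : u < n -> exists d, Some d \in new_label u.
Proof.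
move=> un; have [->|ua] := eqVneq u a; first by rewrite new_label_a; exists dx.
have [->|ub] := eqVneq u b; first by rewrite new_label_b; exists dy.
have [g [gx gy _]] := core_avoid dx; exists (inl g).
by rewrite new_label_Some room_core.
Qed.

Lemma common_new A : clique n N A ->
  exists t, (forall u, A u -> t \in new_label u) /\ (t = None -> F A).
Proof.
move=> kA; have [FA|[d hd]] := F_or_common kA.
  by exists None; split=> // u Au; apply/new_label_None; exists A.
by exists (Some d); split=> // u Au; rewrite new_label_Some hd.
Qed.

(** An identity atom is continued inside its clique, or along the common atom from [F_room]. A
    diversity atom is met by a free colour at [v], unless [v] is [a] or [b], where the definition of
    [room] allows it. *)
Lemma new_label_end u v : u < n -> v < n ->
  new_label u \subset scomp (N u v) (new_label v).
Proof.
move=> un vn; have [<-|uv] := eqVneq u v.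
  apply/subsetP=> t tu; apply: (@mem_scomp _ _ _ _ None t) => //.
    by rewrite (wn_diag wN) ?set11.
  by rewrite triNx.
apply/subsetP=> -[d|]; last first.
  move=> /new_label_None[A FA Au]; have [Av|nAv] := pselect (A v).
    have [_ near _] := F_clique FA.
    apply: (@mem_scomp _ _ _ _ None None); [exact: near| |by []].
    by apply/new_label_None; exists A.
  have [e he hv] := F_room FA vn nAv.
  apply: (@mem_scomp _ _ _ _ (Some e) (Some e)); rewrite ?new_label_Some //.
    exact: he.
  by rewrite trixN.
rewrite new_label_Some => hd.
have [->|va] := eqVneq v a; first by rewrite new_label_a; case/setIP: hd.
have [->|vb] := eqVneq v b; first by rewrite new_label_b; case/setIP: hd.
have [p hp] := wn_div wN un vn uv; have [g [gx gy gd]] := core_avoid d.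
apply: (mem_scomp hp (_ : Some (inl g) \in _)).
  by rewrite new_label_Some room_core.
by rewrite triC tri_gamma; apply: contra gd => /andP[/eqP-> /eqP->].
Qed.

(** An identity atom is covered by the common atom of its clique towards the new point. For a
    diversity atom, a point outside [a], [b] has a free colour in its new label; the pair [a], [b]
    itself is [qxy]. *)
Lemma new_label_mid u v : u < n -> v < n ->
  N u v \subset scomp (new_label u) (new_label v).
Proof.
move=> un vn; apply/subsetP=> -[d|]; last first.
  move=> /(wn_clique wN un vn)[A [kA Au Av]].
  have [t [ht _]] := common_new kA.
  by apply: (mem_scomp (ht u Au) (ht v Av)); rewrite trixN.
wlog: u v un vn / (v != a) && (v != b) => [H|/andP[va vb]] hd.
  have [h|h] := boolP ((v != a) && (v != b)); first exact: H.
  have [h'|h'] := boolP ((u != a) && (u != b)).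
    by rewrite scompC; apply: H => //; rewrite (wn_sym wN).
  move: h h' hd; rewrite !negb_and !negbK => /orP[]/eqP-> /orP[]/eqP->;
    rewrite ?new_label_a ?new_label_b ?(wn_diag wN) ?in_set1 //.
    by rewrite (wn_sym wN) // scompC; apply: (subsetP qxy).
  exact: (subsetP qxy).
have [e he] := new_label_div un; have [g [gx gy gd]] := core_avoid d.
apply: (mem_scomp he (_ : Some (inl g) \in _)).
  by rewrite new_label_Some room_core.
by rewrite triC tri_gamma; apply: contra gd => /andP[/eqP-> /eqP->].
Qed.

Lemma clique_old A t : clique n N A ->
  (forall u, A u -> t \in new_label u) -> t <> None ->
  clique n.+1 (extend [set None] n N new_label) A.
Proof.
move=> [An near adiv]; case: t => // d hd _; split.
- by move=> u /An un; apply: ltnW.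
- by move=> u v Au Av; rewrite extendE ?near ?An.
- move=> v /ltnS_case[->|vn] nAv.
    by exists d => u Au; rewrite extendE ?hd ?An.
  by have [e he] := adiv v vn nAv; exists e => u Au; rewrite extendE ?he // An.
Qed.

Lemma clique_new A : F A ->
  clique n.+1 (extend [set None] n N new_label) (fun u => A u \/ u = n).
Proof.
move=> FA; have [An near adiv] := F_clique FA.
have nn u : A u -> None \in new_label u by move=> Au; apply/new_label_None; exists A.
split.
- by move=> u [/An un|->] //; apply: ltnW.
- by move=> u v [Au|->] [Av|->]; rewrite extendE ?near ?An ?nn ?inE.
- move=> v /ltnS_case[->|vn] nAv; first by case: nAv; right.
  have nAv' : ~ A v by move=> Av; apply: nAv; left.
  have [d hd hv] := F_room FA vn nAv'.
  by exists d => u [Au|->]; rewrite extendE ?hd ?new_label_Some // An.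
Qed.

Lemma weak_network_extend : weak_network n.+1 (extend [set None] n N new_label).
Proof.
split.
- move=> u v /ltnS_case[->|un] /ltnS_case[->|vn]; rewrite ?extendE //.
  exact: (wn_sym wN).
- by move=> u /ltnS_case[->|un]; rewrite extendE // (wn_diag wN).
- move=> u v /ltnS_case[->|un] /ltnS_case[->|vn]; rewrite ?eqxx // ?extendE //.
  + by move=> _; apply: new_label_div.
  + by move=> _; apply: new_label_div.
  + exact: (wn_div wN).
- move=> u v w /ltnS_case[->|un] /ltnS_case[->|vn] /ltnS_case[->|wn];
    rewrite ?extendE //.
  + by apply/subsetP=> t /set1P ->; apply: (@mem_scomp _ _ _ _ None None); rewrite ?set11.
  + by apply/subsetP=> t tw; apply: (@mem_scomp _ _ _ _ None t); rewrite ?set11 ?triNx.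
  + apply/subsetP=> t /set1P ->; have [d hd] := new_label_div vn.
    by apply: (mem_scomp hd hd); rewrite trixN.
  + by rewrite scompC (wn_sym wN) //; apply: new_label_end.
  + by apply/subsetP=> t tw; apply: (@mem_scomp _ _ _ _ t None); rewrite ?set11 ?trixNx.
  + exact: new_label_mid.
  + exact: new_label_end.
  + exact: (wn_comp wN).
- have self : exists A, [/\ clique n.+1 (extend [set None] n N new_label) A, A n & A n].
    exists (fun u => u = n); split=> //; split.
    + by move=> u ->.
    + by move=> u v -> ->; rewrite extendE inE.
    + move=> v /ltnS_case[->//|vn] _; have [d hd] := new_label_div vn.
      by exists d => u ->; rewrite extendE.
  move=> u v /ltnS_case[->|un] /ltnS_case[->|vn] //; rewrite extendE //.
  + move=> /new_label_None[A FA Av]; have kA := clique_new FA.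
    by exists (fun u => A u \/ u = n); split=> //; [right|left].
  + move=> /new_label_None[A FA Av]; have kA := clique_new FA.
    by exists (fun u => A u \/ u = n); split=> //; [left|right].
  + move=> /(wn_clique wN un vn)[A [kA Au Av]].
    have [[d|] [ht tF]] := common_new kA.
      by exists A; split=> //; apply: clique_old ht _.
    exists (fun u => A u \/ u = n); split; [|by left|by left].
    exact: clique_new (tF _).
Qed.

Lemma extension_exists : exists N',
  [/\ agree n N N', weak_network n.+1 N', N' a n = x & N' n b = y].
Proof.
exists (extend [set None] n N new_label); split.
- exact: agree_extend.
- exact: weak_network_extend.
- by rewrite extendE // new_label_a.
- by rewrite extendE // new_label_b.
Qed.
End Extension.

(** * Solving composition requests in weak networks *)

Section Requests.
Variables (n : nat) (N : nat -> nat -> {set T}).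
Hypothesis wN : weak_network n N.

Definition extension a b x y := exists N',
  [/\ agree n N N', weak_network n.+1 N', N' a n = x & N' n b = y].

(** The new point joins no clique. A clique through [a] or [b] obtains its common atom by
    decomposing one of its labels in [scomp x y], where both factors are diversity atoms. *)
Lemma extension_without_identity a b x y dx dy : a < n -> b < n ->
  N a b \subset scomp x y -> x \subset scomp (N a b) y ->
  y \subset scomp (N a b) x -> Some dx \in x -> Some dy \in y ->
  None \notin x -> None \notin y -> extension a b x y.
Proof.
move=> an bn qxy xqy yqx xdx ydy nx ny.
apply: (@extension_exists n N wN a b x y an bn qxy xqy yqx dx dy xdx ydy
  (fun _ => False)) => //; last 2 first.
- by split=> [[]//|h]; rewrite h in nx.
- by split=> [[]//|h]; rewrite h in ny.
move=> A kA; right; have [An near adiv] := kA.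
have [Aa|nAa] := pselect (A a); have [Ab|nAb] := pselect (A b).
- have /(subsetP qxy)/scompP[[d|] [t [dxx ty]]] := near a b Aa Ab; last first.
    by rewrite dxx in nx.
  rewrite trixN => /eqP td; rewrite -td in ty.
  by exists d; apply: clique_common_ab kA Aa Ab dxx ty.
- have [e he] := adiv b bn nAb.
  have /(subsetP qxy)/scompP[[d|] [t [dxx ty h]]] := he a Aa; last first.
    by rewrite dxx in nx.
  by exists d; apply: (clique_common_a kA Aa he dxx ty h).
- have [e he] := adiv a an nAa.
  have := he b Ab; rewrite (wn_sym wN bn an).
  move=> /(subsetP qxy)/scompP[t [[d|] [tx dyy h]]]; last first.
    by rewrite dyy in ny.
  by exists d; apply: (clique_common_b kA Ab he dyy tx); rewrite triC.
- exact: (clique_common wN an bn xdx ydy kA nAa nAb).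
Qed.

(** The new point joins precisely the cliques through both [a] and [b]; one exists because the
    identity atom is in [N a b]. *)
Lemma extension_identity a b x y dx dy : a < n -> b < n ->
  N a b \subset scomp x y -> x \subset scomp (N a b) y ->
  y \subset scomp (N a b) x -> Some dx \in x -> Some dy \in y ->
  None \in N a b -> None \in x -> None \in y -> extension a b x y.
Proof.
move=> an bn qxy xqy yqx xdx ydy nq nx ny.
have [A0 [kA0 A0a A0b]] := wn_clique wN an bn nq.
apply: (@extension_exists n N wN a b x y an bn qxy xqy yqx dx dy xdx ydy
  (fun A => [/\ clique n N A, A a & A b])).
- by move=> A [].
- move=> A v [[An near adiv] Aa Ab] vn nAv; have [d hd] := adiv v vn nAv.
  exists d => //; apply: (roomP (_ : Some d \in _) nx _ (_ : Some d \in _) ny).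
  + by rewrite (wn_sym wN) ?hd.
  + by rewrite trixNx.
  + by rewrite (wn_sym wN) ?hd.
  + by rewrite trixNx.
- move=> A kA; have [An near adiv] := kA.
  (* A decomposition starting with the identity atom is replaced: by [d'] and the identity if
     [d' = e], otherwise by the isosceles triangle on [d'], [e], [e]. *)
  have mix (x' y' : {set T}) e d' : None \in x' -> None \in y' ->
      Some e \in scomp x' y' -> Some d' \in x' ->
      exists d t, [/\ Some d \in x', t \in y' & tri (Some d) t (Some e)].
    move=> nx' ny' /scompP[[d|] [t [dx' ty' h]]] d'x.
      by exists d, t.
    move: h; rewrite triNx => /eqP te; rewrite te in ty'.
    have [d'e|d'e] := eqVneq d' e.
      by exists d', None; split; rewrite // trixNx d'e.
    by exists d', (Some e); split; rewrite // tri_isosceles.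
  have [Aa|nAa] := pselect (A a); have [Ab|nAb] := pselect (A b).
  + by left.
  + right; have [e he] := adiv b bn nAb.
    have [d [t [dxx ty h]]] := mix _ _ _ _ nx ny (subsetP qxy _ (he a Aa)) xdx.
    by exists d; apply: (clique_common_a kA Aa he dxx ty h).
  + right; have [e he] := adiv a an nAa.
    have := he b Ab; rewrite (wn_sym wN bn an) => /(subsetP qxy).
    rewrite scompC => h0; have [d [t [dyy tx h]]] := mix _ _ _ _ ny nx h0 ydy.
    by exists d; apply: (clique_common_b kA Ab he dyy tx h).
  + by right; apply: (clique_common wN an bn xdx ydy kA nAa nAb).
- by split=> // _; exists A0.
- by split=> // _; exists A0.
Qed.

(* The delicate request, where [q <= x ; y] forces the identity atom into [x]
   although it may not be in [q]: the new point joins the cliques around [a]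
   on which [(g, g, g)] triangles through [b] can be avoided. *)
Lemma extension_gamma a b g (x := [set None; Some (inl g)])
    (y := [set Some (inl g)]) :
  a < n -> b < n -> Some (inl g) \in N a b -> N a b != y ->
  (forall v, v < n -> ~ (N a v \subset x /\ N v b \subset y)) ->
  extension a b x y.
Proof.
move=> an bn gq qy unw; set c : S := inl g.
have gam d e : tri (Some c) (Some d) (Some e) = ~~ ((c == d) && (d == e)).
  exact: tri_gamma.
have triG t : Some c != t -> tri t (Some c) (Some c).
  case: t => [d|] h; last by rewrite triNx.
  by rewrite triC gam; apply: contra h => /andP[/eqP <- _].
have other (z : {set T}) : Some c \in z -> z != y -> exists2 t, t \in z & Some c != t.
  move=> cz zy; have [/exists_inP[t tz h]|] := boolP [exists t in z, Some c != t].
    by exists t.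
  rewrite negb_exists_in => /forall_inP h; case/eqP: zy; apply/setP=> t.
  rewrite inE; apply/idP/eqP => [/h|->] //.
  by rewrite negbK => /eqP.
have cx : Some c \in x by rewrite !inE eqxx orbT.
have nx : None \in x by rewrite !inE.
have cy : Some c \in y by rewrite !inE.
have qxy : N a b \subset scomp x y.
  apply/subsetP=> t _; have [->|ct] := eqVneq t (Some c).
    by apply: (mem_scomp nx cy); rewrite triNx.
  apply: (mem_scomp cx cy); rewrite -tri_rot; apply: triG; by rewrite eq_sym.
have ab : a != b.
  by apply: contraTneq gq => ->; rewrite (wn_diag wN) // inE.
have [t0 t0q ct0] := other _ gq qy.
have xqy : x \subset scomp (N a b) y.
  apply/subsetP=> t /set2P[]->.
    by apply: (mem_scomp gq cy); rewrite trixN.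
  by apply: (mem_scomp t0q cy); apply: triG.
have yqx : y \subset scomp (N a b) x.
  apply/subsetP=> t /set1P->.
  by apply: (mem_scomp gq nx); rewrite trixNx.
apply: (@extension_exists n N wN a b x y an bn qxy xqy yqx c c cx cy
  (fun A => [/\ clique n N A, A a, ~ A b, forall v, A v -> Some c \in N v b
    & forall v, v < n -> ~ A v -> v != b -> exists e,
      (forall u, A u -> Some e \in N u v) /\ (e != c \/ N v b != y)])).
- by move=> A [].
- move=> A v [[An near adiv] Aa nAb cA hA] vn nAv.
  have [->|vb] := eqVneq v b.
    by exists c => //; rewrite (room_b wN).
  have [e [he hec]] := hA v vn nAv vb; exists e => //.
  have [t tv ht] : exists2 t, t \in N v b & tri t (Some c) (Some e).
    have [ec|ec] := eqVneq e c; last first.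
      have [p hp] := wn_div wN vn bn vb; exists (Some p) => //.
      by rewrite triC gam; apply: contra ec => /andP[/eqP-> /eqP->].
    case: hec => [|vy]; first by rewrite ec eqxx.
    have [cv|ncv] := boolP (Some c \in N v b).
      by have [t tv ct] := other _ cv vy; exists t; rewrite // ec triG.
    have [p hp] := wn_div wN vn bn vb; exists (Some p) => //.
    by rewrite ec triG //; apply: contraNneq ncv => ->.
  apply: (roomP (_ : Some e \in _) nx _ tv cy ht); last by rewrite trixNx.
  by rewrite (wn_sym wN) ?he.
- move=> A kA; have [An near adiv] := kA.
  have [Aa|nAa] := pselect (A a); have [Ab|nAb] := pselect (A b).
  + by right; exists c; apply: (clique_common_ab kA Aa Ab cx cy).
  + have [e he] := adiv b bn nAb.
    have [ec|ec] := eqVneq e c; last first.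
      right; exists c; apply: (clique_common_a kA Aa he cx cy).
      rewrite -tri_rot; apply: triG; by apply: contra ec => /eqP[->].
    rewrite {}ec in he.
    apply: or_asboolP; rewrite -implyNb; apply/implyP => /asboolPn nF.
    apply/asboolP; exists c.
    have [v [vn nAv vb hv]] : exists v, [/\ v < n, ~ A v, v != b & forall e,
        (forall u, A u -> Some e \in N u v) -> e = c /\ N v b = y].
      apply: contrapT => nv; apply: nF; split=> // v vn nAv vb.
      apply: contrapT => ne; apply: nv; exists v; split=> // s hs.
      split; apply/eqP/negPn/negP => h; apply: ne; exists s; split=> //.
        by left.
      by right.
    have [s he'] := adiv v vn nAv; have [sc vy] := hv s he'.
    rewrite {}sc in he'; move=> u Au; have un := An u Au.
    have /(subsetP (wn_comp wN un bn vn))/scompP[t [s' [tu]]] := he' u Au.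
    rewrite (wn_sym wN) // vy => /set1P-> ht.
    by apply: (roomP (near u a Au Aa) cx _ tu cy ht); rewrite triNx.
  + right; exists c; have [e he] := adiv a an nAa => u Au.
    have [ec|ec] := eqVneq e c.
      have hca := he u Au; rewrite ec in hca.
      apply: (roomP hca nx _ (near u b Au Ab) cy); by rewrite ?trixNx ?triNx.
    apply: (roomP (he u Au) cx _ (near u b Au Ab) cy); last by rewrite triNx.
    exact: tri_isosceles.
  + by right; apply: (clique_common wN an bn cx cy kA nAa nAb).
- split=> // _; exists (fun u => u = a) => //; split=> //.
  + split.
    * by move=> u ->.
    * by move=> u v -> ->; rewrite (wn_diag wN) // inE.
    * move=> v vn va; have [|d hd] := wn_div wN an vn.
        by apply/eqP => h; apply: va.
      by exists d => u ->.
  + by move=> h; rewrite h eqxx in ab.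
  + by move=> v ->.
  (* The singleton of [a] qualifies: where it failed, [N a v] would lie in [x] and [N v b] in [y],
     so [v] would already answer the request. *)
  + move=> v vn /eqP va vb; have [d hd] := wn_div wN an vn (contra_neq esym va).
    apply: contrapT => ne; apply: (unw v vn); split; last first.
      suff /eqP-> : N v b == y by [].
      by apply/negPn/negP => h; apply: ne; exists d; split; [move=> u ->|right].
    apply/subsetP=> -[e|] // ev; rewrite !inE /=; apply/eqP; congr Some.
    apply/eqP/negPn/negP => h; apply: ne.
    by exists e; split; [move=> u ->|left].
- by split=> [[A []]|]; rewrite // inE.
Qed.

(** No two diversity atoms produce [t]. If [t] is a diversity atom, isosceles triangles force it to
    be a colour and the only diversity atom of [x], so [extension_gamma] applies to smaller labels.
    If [t] is the identity, it lies in [x], [y] and [N u w], the case of [extension_identity]. *)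
Lemma solve_request_half u w x y t : u < n -> w < n ->
  N u w \subset scomp x y -> t \in N u w -> None \in x -> t \in y ->
  (forall d e, Some d \in x -> Some e \in y -> ~~ tri (Some d) (Some e) t) ->
  (forall v, v < n -> ~ (N u v \subset x /\ N v w \subset y)) ->
  exists x' y', [/\ x' \subset x, y' \subset y & extension u w x' y'].
Proof.
move=> un wn qxy tq nx ty nt unw.
(* [u] does not answer the request although [N u u] lies in [x], so [N u w] is not contained in
   [y]. *)
have [t' t'q t'y] : exists2 t', t' \in N u w & t' \notin y.
  apply/subsetPn/negP => qy; apply: (unw u un); split=> //.
  by rewrite (wn_diag wN) // sub1set.
have /scompP[[d|] [t1 [dx t1y h]]] := subsetP qxy _ t'q; last first.
  by move: h; rewrite triNx => /eqP e; rewrite e (negPf t'y) in t1y.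
case: t tq ty nt => [c|] tq ty nt.
- have xc e : Some e \in x -> e = c.
    move=> ex; apply/eqP; apply: contraNT (nt _ _ ex ty).
    exact: tri_isosceles.
  have dc := xc d dx; subst d.
  have [g cg] : exists g, c = inl g.
    have := nt _ _ dx ty; rewrite tri_equal.
    by clear; case: c => // g _; exists g.
  subst c; pose x' : {set T} := [set None; Some (inl g)].
  pose y' : {set T} := [set Some (inl g)].
  have xx : x' \subset x by rewrite subUset !sub1set nx.
  have yy : y' \subset y by rewrite sub1set.
  exists x', y'; split=> //; apply: extension_gamma => //.
    by apply: contra t'y => /eqP e; move: t'q; rewrite e => /set1P ->.
  by move=> v vn [h1 h2]; apply: (unw v vn); split;
    [apply: subset_trans h1 xx|apply: subset_trans h2 yy].
- have [t'' t''q t''x] : exists2 t'', t'' \in N u w & t'' \notin x.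
    apply/subsetPn/negP => qx; apply: (unw w wn); split=> //.
    by rewrite (wn_diag wN) // sub1set.
  have /scompP[t2 [[e|] [t2x ey h2]]] := subsetP qxy _ t''q; last first.
    by move: h2; rewrite trixNx => /eqP e; rewrite e (negPf t''x) in t2x.
  (* Keeping only atoms that take part in a triangle over [N u w] secures the two missing
     consistency inclusions. *)
  exists (x :&: scomp (N u w) y), (y :&: scomp (N u w) x).
  split; rewrite ?subsetIl //.
  apply: (@extension_identity _ _ _ _ d e) => //.
  + apply/subsetP=> s' s'q; have /scompP[p [r [px ry hs]]] := subsetP qxy _ s'q.
    apply: (@mem_scomp _ _ _ _ p r) => //; apply/setIP; split=> //.
      by apply: (mem_scomp s'q ry); rewrite tri_rot triC.
    by apply: (mem_scomp s'q px); rewrite tri_rot.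
  + apply/subsetP=> p /setIP[px /scompP[s' [r [s'q ry hp]]]].
    apply: (mem_scomp s'q _ hp); apply/setIP; split=> //.
    by apply: (mem_scomp s'q px); rewrite tri_swap.
  + apply/subsetP=> p /setIP[py /scompP[s' [r [s'q rx hp]]]].
    apply: (mem_scomp s'q _ hp); apply/setIP; split=> //.
    by apply: (mem_scomp s'q py); rewrite tri_swap.
  + apply/setIP; split=> //; apply: (mem_scomp t'q t1y).
    by rewrite tri_rot triC.
  + by apply/setIP; split=> //; apply: (mem_scomp t''q t2x); rewrite tri_rot.
  + by apply/setIP; split=> //; apply: (mem_scomp tq ty).
  + by apply/setIP; split=> //; apply: (mem_scomp tq nx).
Qed.

(** If the diversity parts of [x] and [y] cover [N u w], the identity atom is avoided altogether.
    Otherwise an uncovered atom [t] shows on which side it is needed, and the two sides are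
    exchanged by reversal. *)
Lemma solve_request u w x y : u < n -> w < n -> N u w \subset scomp x y ->
  (forall v, v < n -> ~ (N u v \subset x /\ N v w \subset y)) ->
  exists N', [/\ agree n N N', weak_network n.+1 N', N' u n \subset x
    & N' n w \subset y].
Proof.
move=> un wn qxy unw.
pose x1 := x :\ None; pose y1 := y :\ None.
have [q1|/subsetPn[t tq nt]] := boolP (N u w \subset scomp x1 y1).
  have [t tq] : exists t, t \in N u w.
    have [->|/(wn_div wN un wn)[d]] := eqVneq u w; last by exists (Some d).
    by exists None; rewrite (wn_diag wN) ?set11.
  have some (z : {set T}) p : p \in z :\ None -> exists d, p = Some d.
    by case: p => [d|]; [exists d|rewrite !inE].
  have /scompP[p [r [px ry ht]]] := subsetP q1 _ tq.
  have [[d dp] [e er]] := (some _ _ px, some _ _ ry); subst p r.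
  have [|||||||N' [aN wN' N'x N'y]] :=
    @extension_without_identity u w (x1 :&: scomp (N u w) y1)
      (y1 :&: scomp (N u w) x1) d e un wn.
  - apply/subsetP=> s' s'q; have /scompP[p [r [px' ry' hs]]] := subsetP q1 _ s'q.
    apply: (@mem_scomp _ _ _ _ p r) => //; apply/setIP; split=> //.
      by apply: (mem_scomp s'q ry'); rewrite tri_rot triC.
    by apply: (mem_scomp s'q px'); rewrite tri_rot.
  - apply/subsetP=> p /setIP[px' /scompP[s' [r [s'q ry' hp]]]].
    apply: (mem_scomp s'q _ hp); apply/setIP; split=> //.
    by apply: (mem_scomp s'q px'); rewrite tri_swap.
  - apply/subsetP=> p /setIP[py' /scompP[s' [r [s'q rx' hp]]]].
    apply: (mem_scomp s'q _ hp); apply/setIP; split=> //.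
    by apply: (mem_scomp s'q py'); rewrite tri_swap.
  - apply/setIP; split=> //; apply: (mem_scomp tq ry); by rewrite tri_rot triC.
  - apply/setIP; split=> //; apply: (mem_scomp tq px); by rewrite tri_rot.
  - by rewrite in_setI setD11.
  - by rewrite in_setI setD11.
  exists N'; split=> //; rewrite ?N'x ?N'y.
    by apply: subset_trans (subsetIl _ _) (subsetDl _ _).
  by apply: subset_trans (subsetIl _ _) (subsetDl _ _).
have nt' d e : Some d \in x -> Some e \in y -> ~~ tri (Some d) (Some e) t.
  by move=> dx ey; apply: contra nt; apply: mem_scomp; rewrite !inE.
have /scompP[[d|] [[e|] [dx ey ht]]] := subsetP qxy _ tq.
- by have := nt' _ _ dx ey; rewrite ht.
- move: ht; rewrite trixNx => /eqP te; rewrite te in dx.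
  have qyx : N w u \subset scomp y x by rewrite (wn_sym wN wn un) scompC.
  have tq' : t \in N w u by rewrite (wn_sym wN wn un).
  have nt2 e f : Some e \in y -> Some f \in x -> ~~ tri (Some e) (Some f) t.
    by move=> ey' fx; rewrite triC nt'.
  have unw' v : v < n -> ~ (N w v \subset y /\ N v u \subset x).
    move=> vn [h1 h2]; apply: (unw v vn).
    by rewrite (wn_sym wN un vn) (wn_sym wN vn wn).
  have [y' [x' [yy xx [N' [aN wN' N'w N'u]]]]] :=
    solve_request_half wn un qyx tq' ey dx nt2 unw'.
  exists N'; split=> //.
    by rewrite (wn_sym wN') ?ltnS // ?N'u // ltnW.
  by rewrite (wn_sym wN') ?ltnS // ?N'w // ltnW.
- move: ht; rewrite triNx => /eqP te; rewrite te in ey.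
  have [x' [y' [xx yy [N' [aN wN' N'w N'u]]]]] :=
    solve_request_half un wn qxy tq dx ey nt' unw.
  by exists N'; rewrite N'w N'u.
- move: ht; rewrite triNx => /eqP te; rewrite te in ey.
  have [x' [y' [xx yy [N' [aN wN' N'w N'u]]]]] :=
    solve_request_half un wn qxy tq dx ey nt' unw.
  by exists N'; rewrite N'w N'u.
Qed.
End Requests.

(** * The weak representation *)

Lemma weak_limit : exists N : nat -> nat -> {set T},
  [/\ forall u v, N u v = N v u,
      forall u v, (N u v \subset [set None]) = (u == v),
      forall u v, N u v != set0,
      forall u v w, N u w \subset scomp (N u v) (N v w)
    & forall u w x y, N u w \subset scomp x y ->
        exists v, N u v \subset x /\ N v w \subset y].
Proof.
pose Q : countType := (nat * nat * {set T} * {set T})%type.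
(* The shift in [u.+1 < n] exempts the newest point: a stage answers only requests between earlier
   points. *)
pose Sat (q : Q) n (N : nat -> nat -> {set T}) :=
  let: (u, w, x, y) := q in u.+1 < n -> w.+1 < n -> N u w \subset scomp x y ->
    exists v, [/\ v < n, N u v \subset x & N v w \subset y].
have local_Sat q : local (Sat q).
  case: q => [[[u w] x] y] n N N' aN h un wn.
  have [un' wn'] := (ltnW un, ltnW wn); rewrite -aN // => hq.
  by have [v [vn h1 h2]] := h un wn hq; exists v; rewrite -!aN.
pose Good n (N : nat -> nat -> {set T}) := 0 < n /\ weak_network n N.
have local_Good : local Good.
  by move=> n N N' aN [n0 wN]; split=> //; apply: local_weak_network wN.
have [|g _] := @gamma_avoid m J [::]; first by apply: leq_trans m4.
pose c : S := inl g.
(* A stage must add a point even when its request needs no answer; one joined to [0] by a fixed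
   colour will do. *)
have grow n N : Good n N -> exists N', agree n N N' /\ weak_network n.+1 N'.
  move=> [n0 wN]; have cc : [set Some c] \subset scomp (N 0 0) [set Some c].
    rewrite (wn_diag wN) // sub1set.
    by apply: (mem_scomp (set11 _) (set11 _)); rewrite triNx.
  have c0 : N 0 0 \subset scomp [set Some c] [set Some c].
    rewrite (wn_diag wN) // sub1set.
    by apply: (mem_scomp (set11 _) (set11 _)); rewrite trixN.
  have nc : None \notin [set Some c] by rewrite in_set1.
  have [N' [aN wN' _ _]] := extension_without_identity wN n0 n0 c0 cc cc
    (set11 _) (set11 _) nc nc.
  by exists N'.
have [||N hN] := @limit_network _ Q Good Sat local_Good local_Sat _ 1
    (fun _ _ => [set None]).
- move=> [[[u w] x] y] n N GN; have [n0 wN] := GN.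
  have [[un [wn [hq unw]]]|nreq] := pselect (u < n /\ w < n /\
      N u w \subset scomp x y /\
      forall v, v < n -> ~ (N u v \subset x /\ N v w \subset y)).
    have [N' [aN wN' h1 h2]] := solve_request wN un wn hq unw.
    by exists n.+1, N'; split=> // _ _ _; exists n.
  have [N' [aN wN']] := grow n N GN.
  exists n.+1, N'; split=> //; rewrite /Sat !ltnS => un wn; rewrite -aN // => hq.
  apply: contrapT => nv; apply: nreq; split=> //; split=> //; split=> // v vn [h1 h2].
  by apply: nv; exists v; rewrite -!aN // ltnW.
- split=> //; split.
  + by [].
  + by [].
  + by case=> [|u] [|v].
  + move=> u v w _ _ _; rewrite sub1set.
    by apply: (mem_scomp (set11 _) (set11 _)).
  + move=> u v un vn _; exists (fun u => u = 0); case: u v un vn => [|u] [|v] // _ _.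
    split=> //; split=> [u ->|u v _ _|[|v] //] //; by rewrite set11.
have big b : exists2 n, b <= n & weak_network n N.
  by have [n [bn [_ wN] _]] := hN (0, 0, set0, set0) b; exists n.
exists N; split.
- move=> u v; have [n bn wN] := big (u + v).+1.
  by apply: (wn_sym wN); apply: leq_trans bn; rewrite ltnS ?leq_addr ?leq_addl.
- move=> u v; have [n bn wN] := big (u + v).+1.
  have un : u < n by apply: leq_trans bn; rewrite ltnS leq_addr.
  have vn : v < n by apply: leq_trans bn; rewrite ltnS leq_addl.
  have [<-|uv] := eqVneq u v; first by rewrite (wn_diag wN) // subxx.
  have [d hd] := wn_div wN un vn uv.
  by apply/negP => /subsetP/(_ _ hd); rewrite inE.
- move=> u v; have [n bn wN] := big (u + v).+1.
  have un : u < n by apply: leq_trans bn; rewrite ltnS leq_addr.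
  have vn : v < n by apply: leq_trans bn; rewrite ltnS leq_addl.
  apply/set0Pn; have [<-|uv] := eqVneq u v.
    by exists None; rewrite (wn_diag wN) // set11.
  by have [d hd] := wn_div wN un vn uv; exists (Some d).
- move=> u v w; have [n bn wN] := big (u + v + w).+1.
  apply: (wn_comp wN); apply: leq_trans bn; rewrite ltnS ?leq_addl //.
    by rewrite -addnA leq_addr.
  by rewrite addnAC leq_addl.
- move=> u w x y hq; have [n [bn _ hs]] := hN (u, w, x, y) (u + w).+2.
  have [||v [_ h1 h2]] := hs _ _ hq; last by exists v.
    by apply: leq_trans bn; rewrite !ltnS leq_addr.
  by apply: leq_trans bn; rewrite !ltnS leq_addl.
Qed.

(** Containment of labels in [x] respects intersections, but not unions, as a label may have several
    atoms. Injectivity holds because the requests at the loop on [0] realise every atom as a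
    singleton label. *)
Lemma triangle_algebra_wRRA : wRRA (triangle_algebra m J).
Proof.
split; first exact/triangle_algebra_is_RA/ltnW.
have [N [symN diagN N0 compN solveN]] := weak_limit.
exists nat, (fun _ _ => True), (fun x u v => N u v \subset x).
do !split=> //=.
- move=> x y xy; suff sub (x' y' : {set T}) :
    (forall u v, N u v \subset x' -> N u v \subset y') -> x' \subset y'.
    by apply/eqP; rewrite eqEsubset !sub // => u v; apply xy.
  move=> h; apply/subsetP=> t tx.
  have [|v [hv _]] := solveN 0 0 [set t] [set t].
    apply: subset_trans (_ : [set None] \subset _); first by rewrite diagN.
    by rewrite sub1set; apply: (mem_scomp (set11 _) (set11 _)); rewrite trixN.
  have [s' hs] := set0Pn _ (N0 0 v).
  have st : s' = t by apply/set1P/(subsetP hv).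
  rewrite -st; apply: (subsetP (h 0 v _)) hs.
  by apply: subset_trans hv _; rewrite sub1set.
- by rewrite subset0; move/negP: (N0 u v).
- by move: H; rewrite subsetI => /andP[].
- by move: H; rewrite subsetI => /andP[].
- by move=> [h1 h2]; rewrite subsetI h1.
- by rewrite diagN => /eqP.
- by move=> ->; rewrite diagN.
- by rewrite symN.
- by rewrite symN.
- by move=> /solveN.
- move=> [w [h1 h2]]; apply: subset_trans (compN u w v) _; exact: scompS.
Qed.
End WeakNetworks.

(** * Colourings without monochromatic triangles *)

Section Ramsey.
Variables (m n : nat).

Fixpoint ramsey_bound k := if k is k'.+1 then (k * ramsey_bound k').+1 else 1.

(** Sort the other vertices by the colour of their edge to a fixed [v]: inside the class of [g] no
    edge has colour [g], which leaves one colour fewer. *)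
Lemma ramsey_triangle (c : 'I_n -> 'I_n -> 'I_m) (C : {set 'I_m}) (X : {set 'I_n}) :
  {in X &, forall i j, i != j -> c i j \in C} ->
  {in X & &, forall i j k, i != j -> i != k -> j != k ->
     c i j = c i k -> c j k != c i j} ->
  #|X| <= ramsey_bound #|C|.
Proof.
move kE : #|C| => k; elim: k C X kE => [|k IH] C X kE hC noT.
  rewrite leqNgt; apply/negP => /card_gt1P[i [j [iX jX ij]]].
  by have := hC i j iX jX ij; rewrite (cards0_eq kE) inE.
have [->|[v vX]] := set_0Vmem X; first by rewrite cards0.
rewrite (cardsD1 v) vX add1n ltnS.
pose Y g := [set j in X :\ v | c v j == g].
rewrite -sum1_card (partition_big (c v) [in C]) /=; last first.
  by move=> j /setD1P[jv jX]; apply: hC => //; rewrite eq_sym.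
rewrite -kE -sum_nat_const; apply: leq_sum => g gC.
rewrite sum1dep_card -/(Y g).
have Yin j : j \in Y g -> [/\ j \in X, v != j & c v j = g].
  by rewrite !inE => /andP[/andP[jv jX] /eqP h]; rewrite eq_sym.
apply: (IH (C :\ g)).
- by have := cardsD1 g C; rewrite gC kE => -[].
- move=> i j /Yin[iX vi ci] /Yin[jX vj cj] ij.
  rewrite !inE hC // andbT -ci; apply: noT => //; by rewrite ci cj.
- by move=> i j l /Yin[iX _ _] /Yin[jX _ _] /Yin[lX _ _]; apply: noT.
Qed.
End Ramsey.

(** * Failure of representability *)

Section NotRepresentable.
Variable m : nat.
Hypothesis m0 : 0 < m.
Local Notation L := (ramsey_bound m).+1.
Local Notation J := ('I_L * bool)%type.
Local Notation T := (option ('I_m + J)).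

Lemma triangle_algebra_not_rep (D : Type) (U : Defs.rel D)
    (th : triangle_algebra m J -> Defs.rel D) :
  ~ rep (triangle_algebra m J) D U th.
Proof.
move=> [[[Ur [Us Ut]] [thU [inj [th0 [th1 [thI [thid [thV thC]]]]]]]] [_ thD]].
have no u v (x y : {set T}) : th x u v -> th y u v -> x :&: y = set0 -> False.
  by move=> hx hy h; apply/(th0 u v); rewrite -[r0 _]h; apply/thI.
have mono u v (x y : {set T}) : x \subset y -> th x u v -> th y u v.
  by move=> /setUidPr <- hx; apply/thD; left.
have no1 u v (t : T) (y : {set T}) : th [set t] u v -> th y u v -> t \in y.
  move=> ht hy; apply/negPn/negP => ty; apply: (no _ _ _ _ ht hy).
  by apply/setP=> s; rewrite !inE; apply/negP => /andP[/eqP->]; apply/negP.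
have comp1 u v w (t1 t2 t3 : T) : th [set t1] u v -> th [set t2] v w ->
    th [set t3] u w -> tri t1 t2 t3.
  move=> h1 h2 h3; have h : th (scomp [set t1] [set t2]) u w.
    by apply/thC; exists v.
  by have /scompP[p [r [/set1P-> /set1P->]]] := no1 _ _ _ _ h3 h.
have sym1 u v (t : T) : th [set t] u v -> th [set t] v u.
  by move=> h; apply (thV [set t]).
(* Finiteness and respect for unions enter here: the unit is the union of finitely many atoms. *)
have atom u v : U u v -> exists t : T, th [set t] u v.
  move=> /th1 /= h; have {h} : th (\bigcup_(t in [set: T]) [set t]) u v.
    apply: mono h; apply/subsetP=> t _; apply/bigcupP; exists t; rewrite ?set11 //.
  apply: (big_ind (fun x => th x u v -> exists t, th [set t] u v)).
  - by move/th0.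
  - by move=> x y hx hy /thD[/hx|/hy].
  - by move=> t _ h; exists t.
pose g0 : 'I_m := Ordinal m0.
have [u [u' uu']] : exists u u', th [set Some (inl g0)] u u'.
  apply: contrapT => h.
  have /inj/setP/(_ (Some (inl g0))) : releq (th [set Some (inl g0)]) (th set0).
    move=> u v; split=> [hu|/th0//]; by case: h; exists u, v.
  by rewrite !inE eqxx.
pose s (j : 'I_L) (e : bool) : T := Some (inr (j, e)).
have hv j : exists v, th [set s j false] u v /\ th [set s j true] v u'.
  apply/(thC [set s j false] [set s j true]); apply: mono uu'; rewrite sub1set.
  exact: (mem_scomp (set11 _) (set11 _)).
pose v j := sval (cid (hv j)).
have uv j : th [set s j false] u (v j) by rewrite /v; case: cid => ? [].
have vu j : th [set s j true] (v j) u' by rewrite /v; case: cid => ? [].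
(* A label [s i true] is excluded by the triangle at [u], where the two other atoms are distinct and
   carry [false]; [s i false] is excluded at [u'] likewise. For [j = k] the colour is a dummy. *)
have col j k : exists g, j != k -> th [set Some (inl g)] (v j) (v k).
  have [<-|jk] := eqVneq j k; first by exists g0.
  have Ujk : U (v j) (v k).
    by apply: Ut (Us _ _ (thU _ _ _ (uv j))) (thU _ _ _ (uv k)).
  have [t ht] := atom _ _ Ujk.
  have h1 := comp1 _ _ _ _ _ _ (uv j) ht (uv k).
  have h2 := comp1 _ _ _ _ _ _ ht (vu k) (vu j).
  case: t ht h1 h2 => [[g|[i e]]|] ht; first by exists g.
    rewrite /= !xpair_eqE; case: e {ht}; rewrite !andbF !andbT ?orbF /=.
      by rewrite (negPf jk).
    by rewrite [k == j]eq_sym (negPf jk).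
  by rewrite trixNx => /eqP[] e; rewrite e eqxx in jk.
pose c j k := sval (cid (col j k)).
have hc j k : j != k -> th [set Some (inl (c j k))] (v j) (v k).
  by rewrite /c; case: cid.
(* There is one point more than a colouring by [m] colours without monochromatic triangle allows. *)
have := @ramsey_triangle m L c setT setT; rewrite !cardsT !card_ord ltnn.
move=> bound; suff: false by []; apply: bound => [i j _ _ _|i j k _ _ _ ij ik jk e].
  by rewrite inE.
apply/negP => /eqP e'.
have := comp1 _ _ _ _ _ _ (sym1 _ _ _ (hc i j ij)) (hc i k ik) (hc j k jk).
by rewrite -e e' tri_equal.
Qed.
End NotRepresentable.

(** * Homomorphisms and the evaluation of terms *)

Section Homomorphism.
Variables (A B : ra_sig) (f : B -> A).

Definition is_hom :=
  f (r0 B) = r0 A /\ f (r1 B) = r1 A /\ f (rid B) = rid A /\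
  (forall x, f (rcompl B x) = rcompl A (f x)) /\
  (forall x, f (rconv B x) = rconv A (f x)) /\
  (forall x y, f (radd B x y) = radd A (f x) (f y)) /\
  (forall x y, f (rmul B x y) = rmul A (f x) (f y)) /\
  (forall x y, f (rcomp B x y) = rcomp A (f x) (f y)).

Hypothesis fhom : is_hom.

Lemma is_RA_embedding : injective f -> is_RA A -> is_RA B.
Proof.
case: fhom => f0 [f1 [fi [fc [fv [fa [fm fp]]]]]] finj.
rewrite /is_RA /rle => hA; decompose [and] hA.
by do !split; move=> *; apply: finj; rewrite ?(f0, f1, fi, fc, fv, fa, fm, fp); auto.
Qed.

(** Agreement is asked only on the variables of [t]; this is how a bound on the variables becomes
    usable. *)
Lemma eval_hom (env : nat -> B) (env' : nat -> A) t :
  (forall n, occurs n t -> f (env n) = env' n) ->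
  f (eval B env t) = eval A env' t.
Proof.
case: fhom => f0 [f1 [fi [fc [fv [fa [fm fp]]]]]].
elim: t => [n|||s IH|s IHs t IHt|s IHs t IHt||s IH|s IHs t IHt] h //=.
- exact: h.
- by rewrite fc IH.
- by rewrite fa IHs ?IHt // => n hn; apply: h => /=; [right|left].
- by rewrite fm IHs ?IHt // => n hn; apply: h => /=; [right|left].
- by rewrite fv IH.
- by rewrite fp IHs ?IHt // => n hn; apply: h => /=; [right|left].
Qed.
End Homomorphism.

(** * The subalgebra of unions of classes of atoms *)

Section Subalgebra.
Variables (m : nat) (J : finType) (P : eqType).
Local Notation S := ('I_m + J)%type.
Local Notation T := (option S).
Implicit Types (a b c t : T) (x y : {set T}) (n u v w : nat).

(** Classes must not mix kinds: the identity then forms a class of its own, and spoiled triangles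
    can be repaired within a kind. *)
Definition kind t : option bool :=
  match t with None => None | Some (inl _) => Some true | _ => Some false end.

Variable sg : T -> P.
Hypothesis sg_kind : forall t t', sg t = sg t' -> kind t = kind t'.
Hypothesis m3 : 3 <= m.

Definition closed x := [forall t, forall t', (sg t == sg t') ==> ((t \in x) == (t' \in x))].

Lemma closedP x :
  reflect (forall t t', sg t = sg t' -> (t \in x) = (t' \in x)) (closed x).
Proof.
apply: (iffP forallP) => h t.
  by move=> t' e; have /forallP/(_ t')/implyP := h t; rewrite e eqxx => /(_ isT)/eqP.
by apply/forallP => t'; apply/implyP => /eqP e; rewrite (h _ _ e).
Qed.

(** Gives closure under composition. If [c'] spoils a triangle of diversity atoms, either [a], [b],
    [c'] are one colour and [(c, c', c')] serves, or they are distinct atoms [s_j], one of [a], [b]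
    is [c], and it becomes [c'] too. *)
Lemma tri_transfer a b c c' : sg c = sg c' -> tri a b c ->
  exists a' b', [/\ sg a' = sg a, sg b' = sg b & tri a' b' c'].
Proof.
move=> cc h; have kc := sg_kind cc.
have [h'|] := boolP (tri a b c'); first by exists a, b.
case: a h => [a|]; last by rewrite triNx => /eqP-> _; exists None, c'; rewrite triNx.
case: b => [b|]; last by rewrite trixNx => /eqP-> _; exists c', None; rewrite trixNx.
case: c c' cc kc => [[c|c]|] [[c'|c']|] //= cc _; last by move=> ->.
- case: a b => [a|a] [b|b] //= h; rewrite negbK => /andP[/eqP ab /eqP bc].
  subst a b; exists (Some (inl c)), (Some (inl c')); split=> //=.
  by apply: contra h => /andP[/eqP-> _]; rewrite eqxx.
- case: a b => [a|a] [b|b] //= h; rewrite !negb_or => /and3P[ab bc ac].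
  move: h; rewrite (negPf ab) /= => /orP[]/eqP e; subst c.
    exists (Some (inr a)), (Some (inr c')); split=> //=.
    by rewrite eqxx orbT.
  exists (Some (inr c')), (Some (inr b)); split=> //=.
  by rewrite eqxx !orbT.
Qed.

Lemma closed0 : closed set0. Proof. by apply/closedP => t t' _; rewrite !inE. Qed.
Lemma closedT : closed setT. Proof. by apply/closedP => t t' _; rewrite !inE. Qed.
Lemma closed1 : closed [set None].
Proof.
by apply/closedP => t t' /sg_kind; rewrite !inE; case: t t' => [[?|?]|] [[?|?]|].
Qed.
Lemma closedC x : closed x -> closed (~: x).
Proof. by move=> /closedP h; apply/closedP => t t' e; rewrite !inE (h _ _ e). Qed.
Lemma closedU x y : closed x -> closed y -> closed (x :|: y).
Proof.
by move=> /closedP h /closedP k; apply/closedP => t t' e;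
  rewrite !inE (h _ _ e) (k _ _ e).
Qed.
Lemma closedI x y : closed x -> closed y -> closed (x :&: y).
Proof.
by move=> /closedP h /closedP k; apply/closedP => t t' e;
  rewrite !inE (h _ _ e) (k _ _ e).
Qed.
Lemma closed_comp x y : closed x -> closed y -> closed (scomp x y).
Proof.
move=> /closedP h /closedP k; apply/closedP => t t' e.
have sub c c' : sg c = sg c' -> c \in scomp x y -> c' \in scomp x y.
  move=> cc /scompP[a [b [ax by_ abc]]].
  have [a' [b' [ea eb abc']]] := tri_transfer cc abc.
  by apply: mem_scomp abc'; rewrite ?(h _ _ ea) ?(k _ _ eb).
by apply/idP/idP; apply: sub.
Qed.

Local Notation sub := (exist (fun x => is_true (closed x)) _).

Definition subalgebra : ra_sig :=
  @RASig {x | closed x} (sub closed0) (sub closedT)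
    (fun X => sub (closedC (valP X)))
    (fun X Y => sub (closedU (valP X) (valP Y)))
    (fun X Y => sub (closedI (valP X) (valP Y)))
    (sub closed1) id
    (fun X Y => sub (closed_comp (valP X) (valP Y))).

Definition inclusion (X : subalgebra) : triangle_algebra m J := sval X.

Lemma inclusion_inj : injective inclusion. Proof. exact: val_inj. Qed.

Lemma inclusion_hom : is_hom inclusion. Proof. by do !split. Qed.

Lemma subalgebra_is_RA : is_RA subalgebra.
Proof.
exact: is_RA_embedding inclusion_hom inclusion_inj (triangle_algebra_is_RA J m3).
Qed.

(** * Representing the subalgebra step by step *)

Variables (g g' : 'I_m).
Hypotheses (gg' : g != g') (sgg' : sg (Some (inl g)) = sg (Some (inl g'))).

Definition btri a b c :=
  exists a' b' c', [/\ sg a' = sg a, sg b' = sg b, sg c' = sg c & tri a' b' c'].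

Lemma tri_btri a b c : tri a b c -> btri a b c.
Proof. by move=> h; exists a, b, c. Qed.

Lemma btriC a b c : btri a b c -> btri b a c.
Proof. by move=> [a' [b' [c' [? ? ? ?]]]]; exists b', a', c'; rewrite triC. Qed.

Lemma btri_rot a b c : btri a b c -> btri b c a.
Proof. by move=> [a' [b' [c' [? ? ? ?]]]]; exists b', c', a'; rewrite -tri_rot. Qed.

(* The class of [g] has two members, which makes it a flexible atom of the
   subalgebra. *)
Lemma btri_flexible b c : b != None -> c != None -> btri (Some (inl g)) b c.
Proof.
case: b c => [b|] [c|] // _ _.
have [/andP[/eqP gb /eqP bc]|h] := boolP ((inl g == b) && (b == c)).
  subst b c; exists (Some (inl g')), (Some (inl g)), (Some (inl g)).
  by split=> //; rewrite tri_isosceles // eq_sym.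
by apply: tri_btri; rewrite tri_gamma.
Qed.

(** Labels are single atoms of the full algebra, but triangles need only be consistent up to [sg],
    which is all that closed sets detect. *)
Record strong_network n (N : nat -> nat -> T) : Prop := StrongNetwork {
  sn_sym : forall u v, u < n -> v < n -> N u v = N v u;
  sn_diag : forall u v, u < n -> v < n -> (N u v == None) = (u == v);
  sn_comp : forall u v w, u < n -> v < n -> w < n -> btri (N u v) (N v w) (N u w) }.

Lemma local_strong_network : local strong_network.
Proof.
move=> n N N' aN [sN dN cN]; split.
- by move=> u v un vn; rewrite -!aN // sN.
- by move=> u v un vn; rewrite -aN // dN.
- by move=> u v w un vn wn; rewrite -!aN //; apply: cN.
Qed.

Lemma strong_extension n N u w a b : strong_network n N -> u < n -> w < n ->
  a != None -> b != None -> tri a b (N u w) ->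
  exists N', [/\ agree n N N', strong_network n.+1 N', N' u n = a & N' n w = b].
Proof.
move=> sN un wn a0 b0 h.
(* The flexible colour [g] labels all pairs that the request leaves open. *)
pose f z := if z == u then a else if z == w then b else Some (inl g).
have f0 z : f z != None by rewrite /f; case: ifP => // _; case: ifP.
have fN z z' : z < n -> z' < n -> btri (f z) (f z') (N z z').
  move=> zn z'n; have [<-|zz'] := eqVneq z z'.
    have /eqP-> : N z z == None by rewrite (sn_diag sN).
    by apply: tri_btri; rewrite trixN.
  have N0 : N z z' != None by rewrite (sn_diag sN).
  have [zuw|zuw] := boolP ((z != u) && (z != w)).
    have -> : f z = Some (inl g).
      by rewrite /f; case/andP: zuw => /negPf-> /negPf->.
    exact: btri_flexible.
  have [zuw'|zuw'] := boolP ((z' != u) && (z' != w)).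
    have -> : f z' = Some (inl g).
      by rewrite /f; case/andP: zuw' => /negPf-> /negPf->.
    by apply/btriC; apply: btri_flexible.
  move: zuw zuw' zz'; rewrite !negb_and !negbK.
  move=> /orP[]/eqP-> /orP[]/eqP->; rewrite ?eqxx // => ne.
    rewrite /f eqxx eqxx [w == u]eq_sym (negPf ne).
    exact: tri_btri.
  rewrite /f eqxx eqxx (negPf ne) (sn_sym sN) //.
  exact/btriC/tri_btri.
exists (extend None n N f); split.
- exact: agree_extend.
- split.
  + move=> z z' /ltnS_case[->|zn] /ltnS_case[->|z'n]; rewrite ?extendE //.
    exact: (sn_sym sN).
  + move=> z z' /ltnS_case[->|zn] /ltnS_case[->|z'n]; rewrite ?extendE ?eqxx //.
    * by rewrite (negPf (f0 _)) eq_sym ltn_eqF.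
    * by rewrite (negPf (f0 _)) ltn_eqF.
    * exact: (sn_diag sN).
  + move=> z1 z2 z3 /ltnS_case[->|n1] /ltnS_case[->|n2] /ltnS_case[->|n3];
      rewrite ?extendE //.
    * exact: tri_btri.
    * by apply: tri_btri; rewrite triNx.
    * by apply: tri_btri; rewrite trixN.
    * by apply: btri_rot; apply: btriC; apply: fN.
    * by apply: tri_btri; rewrite trixNx.
    * exact: fN.
    * by apply: btri_rot; apply: btri_rot; apply: btriC; apply: fN.
    * exact: (sn_comp sN).
- by rewrite extendE // /f eqxx.
- rewrite extendE // /f; case: eqP => [wu|_]; last by rewrite eqxx.
  move: h; have /eqP-> : N u w == None by rewrite (sn_diag sN) // wu.
  by rewrite trixN => /eqP.
Qed.

Lemma strong_limit : exists N : nat -> nat -> T,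
  [/\ forall u v, N u v = N v u,
      forall u v, (N u v == None) = (u == v),
      forall u v w, btri (N u v) (N v w) (N u w)
    & forall u w a b, tri a b (N u w) -> exists v, N u v = a /\ N v w = b].
Proof.
pose Q : countType := (nat * nat * T * T)%type.
pose Sat (q : Q) n (N : nat -> nat -> T) :=
  let: (u, w, a, b) := q in u.+1 < n -> w.+1 < n -> tri a b (N u w) ->
    exists v, [/\ v < n, N u v = a & N v w = b].
have local_Sat q : local (Sat q).
  case: q => [[[u w] a] b] n N N' aN h un wn.
  have [un' wn'] := (ltnW un, ltnW wn); rewrite -aN // => hq.
  by have [v [vn h1 h2]] := h un wn hq; exists v; rewrite -!aN.
pose Good n (N : nat -> nat -> T) := 0 < n /\ strong_network n N.
have local_Good : local Good.
  by move=> n N N' aN [n0 sN]; split=> //; apply: local_strong_network sN.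
have [||N hN] := @limit_network _ Q Good Sat local_Good local_Sat _ 1
    (fun _ _ => None).
- move=> [[[u w] a] b] n N [n0 sN].
  have [[un [wn [a0 [b0 hq]]]]|nreq] := pselect (u < n /\ w < n /\
      a != None /\ b != None /\ tri a b (N u w)).
    have [N' [aN sN' h1 h2]] := strong_extension sN un wn a0 b0 hq.
    by exists n.+1, N'; split=> // _ _ _; exists n.
  (* A remaining request is vacuous or involves the identity atom, and then an end point answers it;
     an arbitrary point is added because a stage must grow. *)
  have h0 : tri (Some (inl g)) (Some (inl g)) (N 0 0).
    have /eqP-> : N 0 0 == None by rewrite (sn_diag sN).
    by rewrite trixN.
  have gN : Some (inl g : S) != None by [].
  have [N' [aN sN' _ _]] := strong_extension sN n0 n0 gN gN h0.
  exists n.+1, N'; split=> //; rewrite /Sat !ltnS => un wn; rewrite -aN // => hq.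
  have NN z : z < n -> N' z z = None.
    by move=> zn; rewrite -aN //; apply/eqP; rewrite (sn_diag sN).
  case: a b hq nreq => [a|] [b|] hq nreq; first by case: nreq.
  + move: hq; rewrite trixNx => /eqP hq; exists w.
    by rewrite NN // -aN // ltnW.
  + move: hq; rewrite triNx => /eqP hq; exists u.
    by rewrite NN // -aN // ltnW.
  + move: hq; rewrite triNx => /eqP hq; exists u.
    by rewrite NN // -aN // ltnW.
- split=> //; split=> //; first by case=> [|u] [|v].
  by move=> u v w _ _ _; apply: tri_btri.
have big k : exists2 n, k <= n & strong_network n N.
  by have [n [bn [_ sN] _]] := hN (0, 0, None, None) k; exists n.
exists N; split.
- move=> u v; have [n bn sN] := big (u + v).+1.
  by apply: (sn_sym sN); apply: leq_trans bn; rewrite ltnS ?leq_addr ?leq_addl.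
- move=> u v; have [n bn sN] := big (u + v).+1.
  by apply: (sn_diag sN); apply: leq_trans bn; rewrite ltnS ?leq_addr ?leq_addl.
- move=> u v w; have [n bn sN] := big (u + v + w).+1.
  apply: (sn_comp sN); apply: leq_trans bn; rewrite ltnS ?leq_addl //.
    by rewrite -addnA leq_addr.
  by rewrite addnAC leq_addl.
- move=> u w a b hq; have [n [bn _ hs]] := hN (u, w, a, b) (u + w).+2.
  have [||v [_ h1 h2]] := hs _ _ hq; last by exists v.
    by apply: leq_trans bn; rewrite !ltnS leq_addr.
  by apply: leq_trans bn; rewrite !ltnS leq_addl.
Qed.

(** As a label is one atom, membership in an element respects union and complement. Consistency up
    to [sg] suffices for composition because all elements are closed. *)
Lemma subalgebra_RRA : RRA subalgebra.
Proof.
split; first exact: subalgebra_is_RA.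
have [N [symN diagN compN solveN]] := strong_limit.
have N00 u : N u u = None by apply/eqP; rewrite diagN.
exists nat, (fun _ _ => True), 
  (fun (X : subalgebra) u v => is_true (N u v \in (sval X : {set T}))).
split; last first.
  split=> [x|x y] u v /=; rewrite !inE; split=> //.
  - by move=> /negP.
  - by move=> [_ /negP].
  - by move=> /orP.
  - by move=> /orP.
do !split=> //=.
- move=> x y xy; apply: val_inj; apply/setP => t.
  have [|v [<- _]] := solveN 0 0 t t; first by rewrite N00 trixN.
  by apply/idP/idP; apply xy.
- by rewrite inE.
- by rewrite inE.
- by case/setIP: H.
- by case/setIP: H.
- by move=> [h1 h2]; rewrite inE h1.
- by rewrite inE diagN => /eqP.
- by move=> ->; rewrite inE diagN.
- by rewrite symN.
- by rewrite symN.
- move=> /scompP[a [b [ax by_ /solveN[w [wa wb]]]]].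
  by exists w; rewrite wa wb.
- move=> [w [hx hy]]; have [a [b [c [ea eb ec abc]]]] := compN u w v.
  rewrite -(closedP _ (closed_comp (valP x) (valP y)) _ _ ec).
  apply: mem_scomp abc; first by rewrite (closedP _ (valP x) _ _ ea).
  by rewrite (closedP _ (valP y) _ _ eb).
Qed.
End Subalgebra.

(** * Few elements lie in a representable subalgebra; the contradiction *)

Lemma generated_RRA (m : nat) (J : finType) (l : seq {set option ('I_m + J)}) :
  2 < m -> 2 ^ size l < m ->
  exists (B : ra_sig) (f : B -> triangle_algebra m J),
    [/\ RRA B, is_hom f, injective f & forall x, x \in l -> exists y, f y = x].
Proof.
move=> m3 lm; pose T : finType := option ('I_m + J).
(* Recording membership in each element of [l] makes these elements closed. *)
pose sg (t : T) := (kind t, [seq t \in x | x : {set T} <- l]).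
have sg_kind t t' : sg t = sg t' -> kind t = kind t' by case.
pose h (g : 'I_m) := map_tuple (fun x : {set T} => Some (inl g) \in x) (in_tuple l).
have /injectivePn[g [g' gg' hgg']] : ~~ injectiveb h.
  apply/negP => /injectiveP/leq_card; rewrite card_tuple card_bool card_ord.
  by rewrite leqNgt lm.
have sgg' : sg (Some (inl g)) = sg (Some (inl g')).
  by congr pair; apply: (congr1 val hgg').
exists (subalgebra sg_kind), (inclusion (sg_kind := sg_kind)); split.
- exact: (subalgebra_RRA sg_kind m3 gg' sgg').
- exact: inclusion_hom.
- exact: inclusion_inj.
- move=> x xl; suff cx : closed sg x by exists (exist _ x cx).
  by apply/closedP => t t' [_ /eq_in_map/(_ x xl)].
Qed.

Lemma mem_In (T : eqType) (x : T) (s : seq T) : List.In x s -> x \in s.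
Proof. by elim: s => //= y s IH [->|/IH h]; rewrite inE ?eqxx ?h ?orbT. Qed.

Theorem theorem1 (Sigma : equation -> Prop) :
  (forall A : ra_sig, RRA A <-> (wRRA A /\ Mod Sigma A)) ->
  infinite_set (vars_of Sigma).
Proof.
move=> HS [l hl].
(* [m] exceeds [2 ^ size l] for the pigeonhole argument and is at least 4, so that a colour can
   avoid three given atoms in one-point extensions. *)
pose m := (2 ^ size l + 4)%N; pose J : finType := ('I_(ramsey_bound m).+1 * bool)%type.
have m4 : 4 <= m by rewrite leq_addl.
pose A := triangle_algebra m J.
suff modA : Mod Sigma A.
  have [_ [D [U [th hth]]]] : RRA A.
    by apply/HS; split=> //; apply: triangle_algebra_wRRA.
  by apply: triangle_algebra_not_rep hth; apply: leq_trans m4.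
move=> e Se env.
have [||B [f [BR fhom finj fl]]] := @generated_RRA m J [seq env n | n <- l].
- exact: ltnW.
- by rewrite size_map -addn1 leq_add2l.
have [_ modB] := proj1 (HS B) BR.
(* Variables outside [l] do not occur in [Sigma], so they may take the value [r0 B]. *)
have hy n : exists y, List.In n l -> f y = env n.
  have [nl|nl] := pselect (List.In n l); last by exists (r0 B).
  have [|y yE] := fl (env n); last by exists y.
  by apply: map_f; apply: mem_In.
pose env' n := sval (cid (hy n)).
have env'E n : List.In n l -> f (env' n) = env n by rewrite /env'; case: cid.
have := congr1 f (modB e Se env').
by rewrite !(eval_hom fhom (env' := env)) // => n hn; apply: env'E; apply: hl;
  exists e; split=> //; [right|left].
Qed.
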